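(* Let $\{\mathbb{P}_n\}_{n\ge0}$ be a monic OPS associated with the quasi-definite moment functional $u$ on $\Pi^d$, satisfying the three term relations $x_i\mathbb{P}_n=L_{n,i}\mathbb{P}_{n+1}+B_{n,i}\mathbb{P}_n+C_{n,i}\mathbb{P}_{n-1}$, $n\ge0$, $1\le i\le d$ ($\mathbb{P}_{-1}=0$), and let $H_n=\langle u,\mathbb{P}_n\mathbb{P}_n^t\rangle$. Let $\{M_n\}_{n\ge1}$ and $\{N_n\}_{n\ge2}$ be two sequences of real matrices of orders $r_n^d\times r_{n-1}^d$ and $r_n^d\times r_{n-2}^d$ respectively, such that $N_2\not\equiv0$. Define recursively the monic polynomial system $$\mathbb{Q}_0=\mathbb{P}_0,\qquad \mathbb{Q}_1=\mathbb{P}_1-M_1\mathbb{P}_0,\qquad \mathbb{Q}_n=\mathbb{P}_n-M_n\mathbb{Q}_{n-1}-N_n\mathbb{Q}_{n-2},\quad n\ge2.$$ Then $\{\mathbb{Q}_n\}_{n\ge0}$ is a monic OPS associated with a quasi-definite moment functional $v$, satisfying the three term relations $$x_i\mathbb{Q}_n(\mathbf{x})=L_{n,i}\mathbb{Q}_{n+1}(\mathbf{x})+\hat B_{n,i}\mathbb{Q}_n(\mathbf{x})+\hat C_{n,i}\mathbb{Q}_{n-1}(\mathbf{x}),\qquad 1\le i\le d,$$ with initial conditions $\mathbb{Q}_{-1}(\mathbf{x})=0$, $\hat C_{-1,i}=0$, if and only if, for all $1\le i\le d$, $$\hat B_{n,i}=B_{n,i}-M_nL_{n-1,i}+L_{n,i}M_{n+1}\quad(n\ge0),$$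 $$\hat C_{n,i}=C_{n,i}-M_n\hat B_{n-1,i}+B_{n,i}M_n-N_nL_{n-2,i}+L_{n,i}N_{n+1}\quad(n\ge1),$$ $$M_n\hat C_{n-1,i}+N_n\hat B_{n-2,i}=C_{n,i}M_{n-1}+B_{n,i}N_n\quad(n\ge2),$$ $$C_{n,i}N_{n-1}=N_n\hat C_{n-2,i}\quad(n\ge3),$$ where the terms $M_0L_{-1,i}$ and $N_1L_{-1,i}$ are understood to be zero. In such a case, there exists a polynomial of exact degree two given by $$\lambda(\mathbf{x})=N_2^tH_2^{-1}\mathbb{P}_2+M_1^tH_1^{-1}\mathbb{P}_1+H_0^{-1}\mathbb{P}_0,$$ satisfying $v=\lambda(\mathbf{x})\,u$.
   Context: $\Pi^d$ is the space of real polynomials in $d$ variables, $\Pi^d_n$ the subspace of those of total degree at most $n$; $r_n^d=\binom{n+d-1}{n}$ is the number of monomials of total degree $n$. A moment functional is a linear functional $u:\Pi^d\to\mathbb{R}$, $p\mapsto\langle u,p\rangle$, acting entrywise on matrices of polynomials. For $\lambda\in\Pi^d$, $\lambda u$ is the functional $\langle\lambda u,p\rangle=\langle u,\lambda p\rangle$. Let $\mathbb{X}_n$ be the column vector of all monomials of total degree $n$ in reverse lexicographical order, and let $L_{n,i}$ ($n\ge0$, $1\le i\le d$) be the $r_n^d\times r_{n+1}^d$ matrix defined by $x_i\mathbb{X}_n=L_{n,i}\mathbb{X}_{n+1}$. A polynomial system (PS) is a sequence $\{\mathbb{P}_n\}_{n\ge0}$ of column vectors, $\mathbb{P}_n$ having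 $r_n^d$ entries which are polynomials of total degree $n$, such that for every $n$ the entries of $\mathbb{P}_0,\dots,\mathbb{P}_n$ form a basis of $\Pi_n^d$; it is monic if for all $n$ the entries of $\mathbb{P}_n-\mathbb{X}_n$ have total degree at most $n-1$ (in particular $\mathbb{P}_0=1$). A PS is orthogonal with respect to $u$ (an OPS) if $\langle u,\mathbb{P}_m\mathbb{P}_n^t\rangle=0$ for $m\ne n$ and $H_n=\langle u,\mathbb{P}_n\mathbb{P}_n^t\rangle$ is invertible for all $n\ge0$. $u$ is quasi-definite if an OPS with respect to $u$ exists. It is known that a monic OPS satisfies three term relations $x_i\mathbb{P}_n=L_{n,i}\mathbb{P}_{n+1}+B_{n,i}\mathbb{P}_n+C_{n,i}\mathbb{P}_{n-1}$ with uniquely determined real matrices $B_{n,i}$ ($r_n^d\times r_n^d$) and $C_{n,i}$ ($r_n^d\times r_{n-1}^d$); $\hat B_{n,i}$ and $\hat C_{n,i}$ are real matrices of the same respective sizes. *)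

(* Defs.v *)
From HB Require Import structures.
From mathcomp Require Import all_boot all_order all_algebra.
From mathcomp Require Import reals mpoly.

Set Implicit Arguments.
Unset Strict Implicit.
Unset Printing Implicit Defensive.

Import Order.TTheory GRing.Theory Num.Theory.
Local Open Scope ring_scope.

Definition r (d n : nat) : nat := 'C(n + d - 1, n).

Lemma r0 d : r d 0 = 1%N.
Proof. by rewrite /r bin0. Qed.

(* [r d 0] is only propositionally equal to 1, so a [r d 0]-indexed row or
   column is read off at this index, its only one. *)
Definition ord_r0 (d : nat) : 'I_(r d 0) := cast_ord (esym (r0 d)) ord0.

(* The order [<=%O] on ['X_{1..d}] is lexicographic on exponents among
   monomials of equal degree; it is reversed here, so that x_1 ^ n comes first
   and x_d ^ n last. *)
Definition monos (d n : nat) : seq 'X_{1..d} :=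
  sort >=%O [seq bmnm m | m <- enum {: 'X_{1..d < n.+1}} & mdeg (bmnm m) == n].

Lemma mem_monos d n (m : 'X_{1..d}) : (m \in monos d n) = (mdeg m == n).
Proof.
rewrite /monos mem_sort; apply/mapP/idP => [[b + ->]|/eqP mn].
  by rewrite mem_filter => /andP[].
have lt_m : (mdeg m < n.+1)%N by rewrite mn.
exists (BMultinom lt_m) => //.
by rewrite mem_filter /= mn eqxx mem_enum.
Qed.

Lemma monos_uniq d n : uniq (monos d n).
Proof.
rewrite /monos sort_uniq map_inj_uniq; last exact: val_inj.
by rewrite filter_uniq // enum_uniq.
Qed.

Lemma size_monos d n : (0 < d)%N -> size (monos d n) = r d n.
Proof.
case: d => // d _; rewrite /r addnS subn1 /= -(size_basis d n).
apply/perm_size/uniq_perm; rewrite ?monos_uniq ?uniq_basis // => m.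
by rewrite mem_monos basis_cover.
Qed.

Section Polynomials.
Variables (R : realType) (d : nat).
Implicit Types (n : nat) (i : 'I_d) (p : {mpoly R[d]}).

Definition mono n (j : 'I_(r d n)) : 'X_{1..d} := nth 0%MM (monos d n) j.

Definition Xvec n : 'cV[{mpoly R[d]}]_(r d n) := \col_j 'X_[mono j].

Definition mulrm m n (A : 'M[R]_(m, n)) (V : 'cV[{mpoly R[d]}]_n) :
  'cV[{mpoly R[d]}]_m := map_mx (@mpolyC d R) A *m V.

Definition L n i : 'M[R]_(r d n, r d n.+1) :=
  \matrix_(j, k) ((mono j + U_(i))%MM == mono k)%:R.

Lemma mulX_Xvec n i : 'X_i *: Xvec n = mulrm (L n i) (Xvec n.+1).
Proof.
apply/colP => j; rewrite !mxE -mpolyXD addmC.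
have d0 : (0 < d)%N by case: (d) i => [[]|].
have memm : (mono j + U_(i))%MM \in monos d n.+1.
  rewrite mem_monos mdegD mdeg1 addn1 eqSS -mem_monos.
  by rewrite mem_nth // size_monos.
have lt_k : (index (mono j + U_(i))%MM (monos d n.+1) < r d n.+1)%N.
  by rewrite -size_monos // index_mem.
have mk : mono (Ordinal lt_k) = (mono j + U_(i))%MM by rewrite /mono nth_index.
rewrite (bigD1 (Ordinal lt_k)) //= big1 => [|k ne_k].
  by rewrite !mxE mk eqxx mpolyC1 mul1r addr0.
rewrite !mxE -mk /mono nth_uniq ?monos_uniq ?size_monos //.
by rewrite eq_sym (inj_eq val_inj) (negbTE ne_k) mpolyC0 mul0r.
Qed.

Definition mulfun (lam : {mpoly R[d]}) (u : {scalar {mpoly R[d]}}) p : R :=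
  u (lam * p).

Fact mulfun_is_scalar lam (u : {scalar {mpoly R[d]}}) : scalar (mulfun lam u).
Proof. by move=> a p q; rewrite /mulfun mulrDr -scalerAr linearP. Qed.

HB.instance Definition _ lam (u : {scalar {mpoly R[d]}}) :=
  GRing.isLinear.Build R {mpoly R[d]} R *%R (mulfun lam u)
    (mulfun_is_scalar lam u).

Definition vecseq := forall n, 'cV[{mpoly R[d]}]_(r d n).

(* [msize p = n.+1] says that [p] has total degree [n]; [msize p <= n] that [p]
   is zero or of total degree at most [n - 1]. *)
Definition is_PS (P : vecseq) : Prop :=
  (forall n (j : 'I_(r d n)), msize (P n j 0) = n.+1) /\
  (forall n,
     (forall c : forall k, 'rV[R]_(r d k),
        \sum_(k < n.+1) mulrm (c k) (P k) = 0 ->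
        forall k, (k <= n)%N -> c k = 0) /\
     (forall p, (msize p <= n.+1)%N ->
        exists c : forall k, 'rV[R]_(r d k),
          p%:M = \sum_(k < n.+1) mulrm (c k) (P k))).

Definition is_monic (P : vecseq) : Prop :=
  forall n (j : 'I_(r d n)), (msize ((P n - Xvec n) j 0)%R <= n)%N.

Definition gram (u : {scalar {mpoly R[d]}}) (P : vecseq) n : 'M[R]_(r d n) :=
  map_mx u (P n *m (P n)^T).

Definition is_OPS (u : {scalar {mpoly R[d]}}) (P : vecseq) : Prop :=
  [/\ is_PS P,
      forall m n, m <> n -> map_mx u (P m *m (P n)^T) = 0
    & forall n, gram u P n \in unitmx].

Definition quasi_definite (u : {scalar {mpoly R[d]}}) : Prop :=
  exists P, is_OPS u P.

(* [prev P n] is [P (n - 1)], and 0 for [n = 0]. *)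
Definition prev (P : vecseq) n : 'cV[{mpoly R[d]}]_(r d n.-1) :=
  if n is m.+1 return 'cV_(r d n.-1) then P m else 0.

(* [C 0 i] is a dummy, multiplied by zero. *)
Definition three_term (P : vecseq) (B : forall n, 'I_d -> 'M[R]_(r d n))
    (C : forall n, 'I_d -> 'M[R]_(r d n, r d n.-1)) : Prop :=
  forall n i, 'X_i *: P n =
    mulrm (L n i) (P n.+1) + mulrm (B n i) (P n) + mulrm (C n i) (prev P n).

Definition monic_OPS_with (v : {scalar {mpoly R[d]}}) (Q : vecseq)
    (B : forall n, 'I_d -> 'M[R]_(r d n))
    (C : forall n, 'I_d -> 'M[R]_(r d n, r d n.-1)) : Prop :=
  [/\ quasi_definite v, is_OPS v Q, is_monic Q & three_term Q B C].

(* [M n] has the meaning of M_n for [1 <= n], [N n] that of N_n for [2 <= n];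
   the values at smaller indices are dummies. *)
Definition lambda (u : {scalar {mpoly R[d]}}) (P : vecseq)
    (M : forall n, 'M[R]_(r d n, r d n.-1))
    (N : forall n, 'M[R]_(r d n, r d n.-2)) : {mpoly R[d]} :=
  (mulrm ((N 2%N)^T *m invmx (gram u P 2%N)) (P 2%N)
   + mulrm ((M 1%N)^T *m invmx (gram u P 1%N)) (P 1%N)
   + mulrm (invmx (gram u P 0%N)) (P 0%N)) (ord_r0 d) 0.

End Polynomials.

(* Main.v *)
Require Import Defs.
From mathcomp Require Import all_boot all_order all_algebra.
From mathcomp Require Import reals mpoly ring.

Set Implicit Arguments.
Unset Strict Implicit.
Unset Printing Implicit Defensive.

Import Order.TTheory GRing.Theory Num.Theory.
Local Open Scope ring_scope.

(** Write T_n = x_i Q_n - L_{n,i} Q_{n+1} - Bh_{n,i} Q_n - Ch_{n,i} Q_{n-1}.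
    Substituting P_n = Q_n + M_n Q_{n-1} + N_n Q_{n-2} in the three term relation
    of P expresses T_n + M_n T_{n-1} + N_n T_{n-2} as a combination of
    Q_n, ..., Q_{n-3} whose coefficients are the defects of the four relations.
    A monic system is free, so all T_n vanish iff the four relations hold.

    The functional v = lambda u takes the values 1, M_1, N_2, 0, 0, ... on
    P_0, P_1, ..., hence 1, 0, 0, ... on Q_0, Q_1, ...; the three term relation
    of Q then makes v p Q_n vanish for every p of degree less than n.  The Gram
    matrices of v are invertible because multiplication by lambda, of exact degree
    two, is injective on leading forms. *)

(** * Real matrices acting on vectors of polynomials *)

Section Mulrm.
Variables (R : realType) (d : nat).

Lemma mulrmDl m n (A A' : 'M[R]_(m, n)) (V : 'cV[{mpoly R[d]}]_n) :
  mulrm (A + A') V = mulrm A V + mulrm A' V.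
Proof. by rewrite /mulrm map_mxD mulmxDl. Qed.

Lemma mulrmNl m n (A : 'M[R]_(m, n)) (V : 'cV[{mpoly R[d]}]_n) :
  mulrm (- A) V = - mulrm A V.
Proof. by rewrite /mulrm map_mxN mulNmx. Qed.

Lemma mulrmDr m n (A : 'M[R]_(m, n)) (V W : 'cV[{mpoly R[d]}]_n) :
  mulrm A (V + W) = mulrm A V + mulrm A W.
Proof. exact: mulmxDr. Qed.

Lemma mulrmNr m n (A : 'M[R]_(m, n)) (V : 'cV[{mpoly R[d]}]_n) :
  mulrm A (- V) = - mulrm A V.
Proof. exact: mulmxN. Qed.

Lemma mulrm0l m n (V : 'cV[{mpoly R[d]}]_n) : mulrm (0 : 'M[R]_(m, n)) V = 0.
Proof. by rewrite /mulrm map_mx0 mul0mx. Qed.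

Lemma mulrm0r m n (A : 'M[R]_(m, n)) : mulrm A (0 : 'cV[{mpoly R[d]}]_n) = 0.
Proof. exact: mulmx0. Qed.

Lemma mulrmA l m n (A : 'M[R]_(l, m)) (A' : 'M[R]_(m, n))
    (V : 'cV[{mpoly R[d]}]_n) : mulrm A (mulrm A' V) = mulrm (A *m A') V.
Proof. by rewrite /mulrm map_mxM mulmxA. Qed.

Lemma mulrmZ m n (A : 'M[R]_(m, n)) (a : {mpoly R[d]}) V :
  a *: mulrm A V = mulrm A (a *: V).
Proof. exact: scalemxAr. Qed.

Lemma mulrm_entry m n (A : 'M[R]_(m, n)) (V : 'cV[{mpoly R[d]}]_n) i k :
  mulrm A V i k = \sum_j A i j *: V j k.
Proof. by rewrite mxE; apply: eq_bigr => j _; rewrite mxE mul_mpolyC. Qed.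

Lemma map_mulrmM (u : {scalar {mpoly R[d]}}) l m n (A : 'M[R]_(l, m))
    (V : 'cV[{mpoly R[d]}]_m) (W : 'rV[{mpoly R[d]}]_n) :
  map_mx u (mulrm A V *m W) = A *m map_mx u (V *m W).
Proof.
rewrite /mulrm -mulmxA; move: (V *m W) => X.
apply/matrixP => i k; rewrite !mxE linear_sum; apply: eq_bigr => j _.
by rewrite !mxE mul_mpolyC linearZ.
Qed.

Lemma map_Mmulrm (u : {scalar {mpoly R[d]}}) l m n (A : 'M[R]_(m, n))
    (V : 'cV[{mpoly R[d]}]_n) (W : 'cV[{mpoly R[d]}]_l) :
  map_mx u (W *m (mulrm A V)^T) = map_mx u (W *m V^T) *m A^T.
Proof.
apply: trmx_inj; rewrite (trmx_mul _ A^T) trmxK !map_trmx.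
by rewrite (trmx_mul W) (trmx_mul W) !trmxK map_mulrmM.
Qed.

Lemma map_mulrm (u : {scalar {mpoly R[d]}}) m n (A : 'M[R]_(m, n))
    (V : 'cV[{mpoly R[d]}]_n) : map_mx u (mulrm A V) = A *m map_mx u V.
Proof. by rewrite -[mulrm A V]mulmx1 map_mulrmM mulmx1. Qed.

End Mulrm.

(** * Degree bounds for vectors of polynomials *)

Section Degree.
Variables (R : realType) (d : nat).

(** [msize] is the total degree plus one, and 0 at the zero polynomial; so [degree_lt 0] says that
    the vector vanishes. *)
Definition degree_lt m n (V : 'cV[{mpoly R[d]}]_m) : Prop :=
  forall j, (msize (V j 0%R) <= n)%N.

Lemma degree_ltW m n n' (V : 'cV[{mpoly R[d]}]_m) :
  (n <= n')%N -> degree_lt n V -> degree_lt n' V.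
Proof. by move=> le_n hV j; exact: leq_trans (hV j) le_n. Qed.

Lemma msizeB_leq n (p q : {mpoly R[d]}) :
  (msize p <= n)%N -> (msize q <= n)%N -> (msize (p - q)%R <= n)%N.
Proof.
move=> hp hq; apply: leq_trans (msizeD_le _ _) _.
by rewrite geq_max hp mmeasureN.
Qed.

Lemma msize_sum_leq (I : Type) (s : seq I) n (F : I -> {mpoly R[d]}) :
  (forall i, (msize (F i) <= n)%N) -> (msize (\sum_(i <- s) F i)%R <= n)%N.
Proof.
move=> hF; elim/big_ind: _ => [|p q hp hq|i _]; first by rewrite mmeasure0.
  by apply: leq_trans (msizeD_le _ _) _; rewrite geq_max hp.
exact: hF.
Qed.

Lemma degree_ltB m n (V W : 'cV[{mpoly R[d]}]_m) :
  degree_lt n V -> degree_lt n W -> degree_lt n (V - W).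
Proof. by move=> hV hW j; rewrite !mxE; apply: msizeB_leq. Qed.

Lemma degree_ltN m n (V : 'cV[{mpoly R[d]}]_m) :
  degree_lt n V -> degree_lt n (- V).
Proof. by move=> hV j; rewrite !mxE mmeasureN. Qed.

Lemma degree_ltD m n (V W : 'cV[{mpoly R[d]}]_m) :
  degree_lt n V -> degree_lt n W -> degree_lt n (V + W).
Proof. by move=> hV hW; rewrite -[W]opprK; apply/degree_ltB/degree_ltN. Qed.

Lemma degree_lt_mulrm l m n (A : 'M[R]_(l, m)) (V : 'cV[{mpoly R[d]}]_m) :
  degree_lt n V -> degree_lt n (mulrm A V).
Proof.
move=> hV j; rewrite mulrm_entry; apply: msize_sum_leq => k.
exact: leq_trans (msizeZ_le _ _) (hV k).
Qed.

Lemma mcoeff_degree n (p : {mpoly R[d]}) m :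
  (msize p <= n)%N -> (n <= mdeg m)%N -> p@_m = 0.
Proof. by move=> hp hm; apply/memN_msupp_eq0/msize_mdeg_ge/(leq_trans hp). Qed.

End Degree.

(** * Monic systems as graded bases of the polynomials *)

Section Monic.
Variables (R : realType) (d : nat) (d_gt0 : (0 < d)%N).
Variables (Q : vecseq R d) (monicQ : is_monic Q).

Lemma mdeg_mono n (j : 'I_(r d n)) : mdeg (mono j) = n.
Proof. by apply/eqP; rewrite -mem_monos mem_nth // size_monos. Qed.

Lemma mono_inj n : injective (@mono d n).
Proof.
move=> j k /eqP; rewrite /mono nth_uniq ?monos_uniq ?size_monos // => /eqP.
exact: val_inj.
Qed.

Lemma mono_surj n (m : 'X_{1..d}) : mdeg m = n -> exists j, m = @mono d n j.
Proof.
move=> /eqP; rewrite -mem_monos => mm.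
have lt_m : (index m (monos d n) < r d n)%N by rewrite -size_monos // index_mem.
by exists (Ordinal lt_m); rewrite /mono nth_index.
Qed.

Lemma degree_monic n : degree_lt n.+1 (Q n).
Proof.
rewrite -[Q n](subrK (Xvec R d n)); apply: degree_ltD.
  by apply: degree_ltW (leqnSn n) _; exact: monicQ.
by move=> j; rewrite !mxE msizeX mdeg_mono.
Qed.

Lemma mcoeff_monic n (j k : 'I_(r d n)) : (Q n k 0)@_(mono j) = (k == j)%:R.
Proof.
have -> : Q n k 0 = (Q n - Xvec R d n) k 0 + 'X_[mono k] by rewrite !mxE subrK.
rewrite mcoeffD (mcoeff_degree (monicQ k)) ?mdeg_mono // add0r mcoeffX.
by rewrite (inj_eq (@mono_inj n)).
Qed.

Lemma mcoeff_mulrm_monic m n (A : 'M[R]_(m, r d n)) i j :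
  (mulrm A (Q n) i 0)@_(mono j) = A i j.
Proof.
rewrite mulrm_entry raddf_sum (bigD1 j) //= big1 => [|k ne_kj].
  by rewrite mcoeffZ mcoeff_monic eqxx mulr1 addr0.
by rewrite mcoeffZ mcoeff_monic (negbTE ne_kj) mulr0.
Qed.

(** [V] contains no monomial of degree [n], so the coefficients of degree [n] in the sum are the
    entries of [A]. Repeated use peels a vanishing combination one degree at a time. *)
Lemma monic_free m n (A : 'M[R]_(m, r d n)) V :
  mulrm A (Q n) + V = 0 -> degree_lt n V -> A = 0 /\ V = 0.
Proof.
move=> eq0 hV; suff A0 : A = 0 by rewrite A0 mulrm0l add0r in eq0.
apply/matrixP => i j; rewrite -mcoeff_mulrm_monic.
move/eqP: eq0; rewrite addr_eq0 => /eqP ->.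
by rewrite !mxE mcoeffN (mcoeff_degree (hV i)) ?mdeg_mono ?oppr0.
Qed.

Lemma msize_mulrm_monic m n (A : 'M[R]_(m, r d n)) i j :
  A i j != 0 -> msize (mulrm A (Q n) i 0) = n.+1.
Proof.
rewrite -mcoeff_mulrm_monic -mcoeff_msupp => /msize_mdeg_lt.
rewrite mdeg_mono => lt_n; apply/eqP; rewrite eqn_leq lt_n andbT.
exact/degree_lt_mulrm/degree_monic.
Qed.

Lemma degree_sum_monic m n (c : forall k, 'M[R]_(m, r d k)) :
  degree_lt n (\sum_(k < n) mulrm (c k) (Q k)).
Proof.
move=> j; rewrite summxE; apply: msize_sum_leq => k.
apply/degree_lt_mulrm/(degree_ltW (ltn_ord k))/degree_monic.
Qed.

Lemma monic_span n p : (msize p <= n)%N ->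
  exists c : forall k, 'rV[R]_(r d k), p%:M = \sum_(k < n) mulrm (c k) (Q k).
Proof.
elim: n p => [|n IHn] p.
  rewrite leqn0 mmeasure_poly_eq0 => /eqP ->.
  by exists (fun=> 0); rewrite big_ord0 raddf0.
(* Subtracting [mulrm a (Q n)] cancels the whole part of degree [n] of [p]: a leading monomial of
   that degree would have coefficient zero. *)
move=> hp; pose a : 'rV[R]_(r d n) := \row_j p@_(mono j).
have hq : (msize (p - mulrm a (Q n) 0 0)%R <= n)%N.
  rewrite leqNgt; apply/negP => lt_n.
  have q_neq0 : p - mulrm a (Q n) 0 0 != 0.
    by rewrite -(mmeasure_poly_eq0 mdeg) -lt0n (leq_ltn_trans _ lt_n).
  have deg_q : mdeg (mlead (p - mulrm a (Q n) 0 0)) = n.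
    apply/eqP; rewrite -eqSS mlead_deg // eqn_leq lt_n andbT.
    apply: msizeB_leq => //; exact/degree_lt_mulrm/degree_monic.
  have [j mj] := mono_surj deg_q.
  move: q_neq0; rewrite -mleadc_eq0 mj mcoeffB mcoeff_mulrm_monic mxE.
  by rewrite subrr eqxx.
have [c hc] := IHn _ hq.
exists (fun k => if k == n then \row_j p@_(mono j) else c k).
rewrite big_ord_recr /= eqxx.
under eq_bigr => k _ do rewrite (ltn_eqF (ltn_ord k)).
rewrite -hc; apply/matrixP => i k; rewrite !ord1 [RHS]mxE !mxE !mulr1n.
by rewrite subrK.
Qed.

Lemma monic_PS : is_PS Q.
Proof.
split=> [n j|n].
  have := @msize_mulrm_monic _ n 1%:M j j.
  by rewrite /mulrm map_mx1 mul1mx mxE eqxx oner_eq0 => ->.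
split=> [c|p]; last exact: monic_span.
elim: n => [|n IHn]; rewrite big_ord_recr /= addrC => eq0 k.
  have [c0 _] := monic_free eq0 (degree_sum_monic _ _).
  by rewrite leqn0 => /eqP ->.
have [c0 /IHn hc] := monic_free eq0 (degree_sum_monic _ _).
by rewrite leq_eqVlt => /predU1P[-> //|]; rewrite ltnS; apply: hc.
Qed.

(** The remainder [Q 0 - Xvec 0] has [msize] 0, hence is zero, and the only monomial of degree 0 is
    1. *)
Lemma monic0 j : Q 0 j 0 = 1.
Proof.
have := monicQ j; rewrite leqn0 mmeasure_poly_eq0 !mxE subr_eq0 => /eqP ->.
by have /eqP := mdeg_mono j; rewrite mdeg_eq0 => /eqP ->; rewrite mpolyX0.
Qed.

End Monic.

(** * The three term relation of Q and the four matrix relations *)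

Ltac mulrm_expand :=
  rewrite ?(mulrmDl, mulrmDr, mulrmNl, mulrmNr, mulrmA, mulrmZ, scalerDr, scalerN).

(** Once the matrix products are collected in the coefficients, each [mulrm] block is made opaque,
    so that [ring] can check the identity entry by entry. *)
Ltac mulrm_ring :=
  mulrm_expand; repeat match goal with |- context [mulrm ?A ?V] =>
    let W := fresh "W" in set W := mulrm A V; clearbody W end;
  apply/colP => j; rewrite !mxE; ring.

Section ThreeTerm.
Variables (R : realType) (d : nat).
Variables (P : vecseq R d).
Variables (B : forall n, 'I_d -> 'M[R]_(r d n)).
Variables (C : forall n, 'I_d -> 'M[R]_(r d n, r d n.-1)).
Hypothesis (ttrP : three_term P B C).
Variables (M : forall n, 'M[R]_(r d n, r d n.-1)).
Variables (N : forall n, 'M[R]_(r d n, r d n.-2)).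
Variables (Q : vecseq R d).
Hypothesis (hQ0 : Q 0%N = P 0%N).
Hypothesis (hQ1 : Q 1%N = P 1%N - mulrm (M 1%N) (P 0%N)).
Hypothesis (hQ : forall n : nat,
  Q n.+2 = P n.+2 - mulrm (M n.+2) (Q n.+1) - mulrm (N n.+2) (Q n)).
Variables (Bh : forall n, 'I_d -> 'M[R]_(r d n)).
Variables (Ch : forall n, 'I_d -> 'M[R]_(r d n, r d n.-1)).

Let P1E : P 1%N = Q 1%N + mulrm (M 1%N) (Q 0%N).
Proof. by rewrite hQ1 hQ0 subrK. Qed.

Let PE n : P n.+2 = Q n.+2 + mulrm (M n.+2) (Q n.+1) + mulrm (N n.+2) (Q n).
Proof. by rewrite hQ addrAC !subrK. Qed.

Definition defect n i : 'cV[{mpoly R[d]}]_(r d n) :=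
  'X_i *: Q n - mulrm (L R n i) (Q n.+1) - mulrm (Bh n i) (Q n)
  - mulrm (Ch n i) (Defs.prev Q n).

(** Indices are shifted so that predecessors compute: [defectB n] belongs to the first relation at n
    + 1, [defectC n] and [defectM n] to the second and third at n + 2. *)
Definition defectB n i : 'M[R]_(r d n.+1) :=
  B n.+1 i - M n.+1 *m L R n i + L R n.+1 i *m M n.+2 - Bh n.+1 i.

Definition defectC n i : 'M[R]_(r d n.+2, r d n.+1) :=
  C n.+2 i - M n.+2 *m Bh n.+1 i + B n.+2 i *m M n.+2
  - N n.+2 *m L R n i + L R n.+2 i *m N n.+3 - Ch n.+2 i.

Definition defectM n i : 'M[R]_(r d n.+2, r d n) :=
  C n.+2 i *m M n.+1 + B n.+2 i *m N n.+2
  - (M n.+2 *m Ch n.+1 i + N n.+2 *m Bh n i).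

(** Indices 0, 1 and 2 are treated apart because the general identity [defect3] would there involve
    terms of negative index. *)
Lemma defect0 i :
  defect 0 i = mulrm (B 0%N i + L R 0%N i *m M 1%N - Bh 0%N i) (Q 0%N).
Proof.
have := ttrP 0 i; rewrite /defect /= !mulrm0r -hQ0 P1E => ->.
mulrm_ring.
Qed.

Lemma defect1 i :
  defect 1 i + mulrm (M 1%N) (defect 0 i) =
  mulrm (defectB 0 i) (Q 1%N)
  + mulrm (C 1%N i - M 1%N *m Bh 0%N i + B 1%N i *m M 1%N + L R 1%N i *m N 2%N
           - Ch 1%N i) (Q 0%N).
Proof.
have := ttrP 1 i; rewrite /defect /defectB /= -hQ0 PE P1E.
(* The relation of [P] is solved for ['X_i *: Q 1]; after substitution the terms in ['X_i *: Q 0]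
   cancel. The next two identities follow the same pattern. *)
mulrm_expand => /(canRL (addrK _)) ->; rewrite ?mulrm0r.
mulrm_ring.
Qed.

Lemma defect2 i :
  defect 2 i + mulrm (M 2%N) (defect 1 i) + mulrm (N 2%N) (defect 0 i) =
  mulrm (defectB 1 i) (Q 2%N) + mulrm (defectC 0 i) (Q 1%N)
  + mulrm (defectM 0 i) (Q 0%N).
Proof.
have := ttrP 2 i; rewrite /defect /defectB /defectC /defectM /= !PE P1E.
mulrm_expand => /(canRL (addrK _)) /(canRL (addrK _)) ->; rewrite ?mulrm0r.
mulrm_ring.
Qed.

Lemma defect3 n i :
  defect n.+3 i + mulrm (M n.+3) (defect n.+2 i)
  + mulrm (N n.+3) (defect n.+1 i) =
  mulrm (defectB n.+2 i) (Q n.+3) + mulrm (defectC n.+1 i) (Q n.+2)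
  + mulrm (defectM n.+1 i) (Q n.+1)
  + mulrm (C n.+3 i *m N n.+2 - N n.+3 *m Ch n.+1 i) (Q n).
Proof.
have := ttrP n.+3 i; rewrite /defect /defectB /defectC /defectM /= !PE.
mulrm_expand => /(canRL (addrK _)) /(canRL (addrK _)) ->.
mulrm_ring.
Qed.

Definition relations i : Prop :=
  [/\ Bh 0%N i = B 0%N i + L R 0%N i *m M 1%N
      /\ (forall n : nat, Bh n.+1 i =
            B n.+1 i - M n.+1 *m L R n i + L R n.+1 i *m M n.+2),
      Ch 1%N i = C 1%N i - M 1%N *m Bh 0%N i + B 1%N i *m M 1%N
                 + L R 1%N i *m N 2%N
      /\ (forall n : nat, Ch n.+2 i =
            C n.+2 i - M n.+2 *m Bh n.+1 i + B n.+2 i *m M n.+2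
            - N n.+2 *m L R n i + L R n.+2 i *m N n.+3),
      forall n : nat,
        M n.+2 *m Ch n.+1 i + N n.+2 *m Bh n i
        = C n.+2 i *m M n.+1 + B n.+2 i *m N n.+2
    & forall n : nat, C n.+3 i *m N n.+2 = N n.+3 *m Ch n.+1 i].

Lemma three_termP :
  three_term Q Bh Ch <-> forall i n, defect n i = 0.
Proof.
split=> [ttrQ i n|defQ n i].
  by rewrite /defect ttrQ; apply/colP => j; rewrite !mxE; ring.
by have /eqP := defQ i n; rewrite /defect !subr_eq add0r [X in _ == X]addrC
  [X in _ + X]addrC addrA => /eqP.
Qed.

(** The relations annihilate the right-hand sides, leaving T_n = - M_n T_{n-1} - N_n T_{n-2}, so
    vanishing propagates upwards. *)
Lemma relations_defect i : relations i -> forall n, defect n i = 0.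
Proof.
move=> [[hB0 hB] [hC1 hC] hM hN].
have dB n : defectB n i = 0 by rewrite /defectB hB subrr.
have dC n : defectC n i = 0 by rewrite /defectC hC subrr.
have dM n : defectM n i = 0 by rewrite /defectM hM subrr.
have d0 : defect 0 i = 0 by rewrite defect0 hB0 subrr mulrm0l.
have d1 : defect 1 i = 0.
  by have := defect1 i; rewrite d0 dB hC1 subrr !mulrm0l mulrm0r !addr0.
have d2 : defect 2 i = 0.
  by have := defect2 i; rewrite d0 d1 dB dC dM !mulrm0l !mulrm0r !addr0.
suff: forall n, [/\ defect n i = 0, defect n.+1 i = 0 & defect n.+2 i = 0].
  by move=> dn n; have [] := dn n.
elim=> // n [_ dn1 dn2]; split=> //.
have := defect3 n i.
by rewrite dn1 dn2 dB dC dM hN subrr !mulrm0l !mulrm0r !addr0.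
Qed.

Hypotheses (d_gt0 : (0 < d)%N) (monicQ : is_monic Q).

(** With every T_n zero, the defect identities are vanishing combinations of the [Q n]; freeness
    extracts their coefficients from the highest degree down. *)
Lemma defect_relations i : (forall n, defect n i = 0) -> relations i.
Proof.
move=> dQ; have deg := degree_monic d_gt0 monicQ.
have free := monic_free d_gt0 monicQ.
have dQ0 n m (A : 'M_(n, _)) : mulrm A (defect m i) = 0.
  by rewrite dQ mulrm0r.
have mulQ l m n (A : 'M_(m, r d n)) : (n < l)%N -> degree_lt l (mulrm A (Q n)).
  by move=> lt_nl; apply/degree_lt_mulrm/(degree_ltW lt_nl).
have zero_deg m n : degree_lt n (0 : 'cV[{mpoly R[d]}]_m).
  by move=> j; rewrite mxE mmeasure0.
have free1 m n (A : 'M_(m, r d n)) : mulrm A (Q n) = 0 -> A = 0.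
  by rewrite -[mulrm _ _]addr0 => /free[].
have e0 : B 0%N i + L R 0%N i *m M 1%N - Bh 0%N i = 0.
  by have := defect0 i; rewrite dQ => /esym /free1.
have [b0 c1] : defectB 0 i = 0 /\ C 1%N i - M 1%N *m Bh 0%N i + B 1%N i *m M 1%N
    + L R 1%N i *m N 2%N - Ch 1%N i = 0.
  have := defect1 i; rewrite dQ dQ0 addr0 => /esym /free[]; first exact: mulQ.
  by move=> -> /free1.
have [b1 [c0 m0]] : defectB 1 i = 0 /\ defectC 0 i = 0 /\ defectM 0 i = 0.
  (* Nesting the sum to the right puts the highest [Q] in front of a remainder of lower degree, the
     shape that [monic_free] expects. *)
  have := defect2 i; rewrite dQ !dQ0 !addr0 -!addrA => /esym /free[].
    by apply: degree_ltD; exact: mulQ.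
  move=> -> /free[]; first exact: mulQ.
  by move=> -> /free1.
have e3 n : [/\ defectB n.+2 i = 0, defectC n.+1 i = 0, defectM n.+1 i = 0 &
    C n.+3 i *m N n.+2 - N n.+3 *m Ch n.+1 i = 0].
  have := defect3 n i; rewrite dQ !dQ0 !addr0 -!addrA => /esym /free[].
    by do !apply: degree_ltD; apply: mulQ; rewrite // ltnS leqW.
  move=> -> /free[]; first by apply: degree_ltD; apply: mulQ; rewrite // ltnS leqW.
  move=> -> /free[]; first exact: mulQ.
  by move=> -> /free1.
split; first split.
- by apply/esym/subr0_eq.
- by case=> [|[|n]]; apply/esym/subr0_eq => //; have [] := e3 n.
- by split=> [|[|n]]; apply/esym/subr0_eq => //; have [] := e3 n.
- by case=> [|n]; apply/esym/subr0_eq => //; have [] := e3 n.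
- by move=> n; apply/subr0_eq; have [] := e3 n.
Qed.

Lemma three_term_relations : three_term Q Bh Ch <-> forall i, relations i.
Proof.
split=> [/three_termP dQ i|rel]; first exact: defect_relations.
by apply/three_termP => i; apply: relations_defect.
Qed.

End ThreeTerm.

(** * Orthogonality derived from a three term relation *)

Section Orthogonality.
Variables (R : realType) (d : nat) (d_gt0 : (0 < d)%N).
Implicit Types (u v w : {scalar {mpoly R[d]}}) (Q : vecseq R d).

Lemma scalar_eq_on_monic Q v w a : is_monic Q ->
  (forall n, map_mx v (Q n) = a *: map_mx w (Q n)) -> forall p, v p = a * w p.
Proof.
move=> monicQ eq_vw p.
have [c /matrixP/(_ 0 0)] := monic_span d_gt0 monicQ (leqnn (msize p)).
rewrite mxE eqxx mulr1n => ->; rewrite summxE !linear_sum mulr_sumr.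
apply: eq_bigr => k _; have := map_mulrm v (c k) (Q k).
rewrite eq_vw -scalemxAr -map_mulrm => /matrixP/(_ 0 0).
by rewrite !mxE.
Qed.

(** Multiplication by a variable lowers the index of [Q] by at most one, so fewer than [n] variables
    turn [Q n] into a combination of vectors of positive index, where [v] vanishes. *)
Lemma orthogonal_lower_degree Q v Bh Ch : three_term Q Bh Ch ->
  (forall n, map_mx v (Q n.+1) = 0) ->
  forall n p, (msize p <= n)%N -> map_mx v (p *: Q n) = 0.
Proof.
move=> ttrQ vQ.
have monoQ k : forall n m, mdeg m = k -> (k < n)%N ->
    map_mx v ('X_[m] *: Q n) = 0.
  elim: k => [|k IHk] [|n] m //.
    by move=> /eqP; rewrite mdeg_eq0 => /eqP -> _; rewrite mpolyX0 scale1r.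
  move=> deg_m; rewrite ltnS => lt_kn.
  have [i m_i] : exists i, (0 < m i)%N.
    apply/existsP; apply: contraTT isT => /existsPn m0.
    suff m_eq0 : m = 0%MM by rewrite m_eq0 mdeg0 in deg_m.
    by apply/mnmP => i; rewrite mnm0E; have := m0 i; case: (m i).
  have le_im : (U_(i) <= m)%MM.
    by apply/mnm_lepP => j; rewrite mnm1E; case: eqP => // <-.
  have deg_m' : mdeg (m - U_(i))%MM = k.
    have := congr1 mdeg (submK le_im); rewrite mdegD mdeg1 deg_m addn1.
    by case.
  (* One variable is split off and absorbed by the three term relation; the resulting indices n + 2,
     n + 1 and n all exceed the degree [k] of the remaining monomial. *)
  rewrite -(submK le_im) mpolyXD -scalerA ttrQ !scalerDr !mulrmZ /=.
  by rewrite !map_mxD !map_mulrm !IHk ?mulmx0 ?addr0 // ltnW // ltnW.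
move=> n p le_pn; apply/colP => j; rewrite !mxE [p]mpolyE mulr_suml.
rewrite linear_sum big_seq big1 // => m m_p.
have lt_mn : (mdeg m < n)%N by apply: leq_trans le_pn; exact: msize_mdeg_lt.
have /matrixP/(_ j 0) := monoQ _ n m erefl lt_mn; rewrite !mxE => vm0.
by rewrite -scalerAl linearZ vm0; apply: mulr0.
Qed.

Lemma map_mulmx_tr_eq0 u l m (V : 'cV[{mpoly R[d]}]_l)
    (W : 'cV[{mpoly R[d]}]_m) :
  (forall j, map_mx u (V j 0 *: W) = 0) -> map_mx u (V *m W^T) = 0.
Proof.
move=> uVW; apply/matrixP => i j; have /matrixP/(_ j 0) := uVW i.
by rewrite !mxE big_ord1 mxE.
Qed.

Lemma orthogonal_monic Q v Bh Ch : is_monic Q -> three_term Q Bh Ch ->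
  (forall n, map_mx v (Q n.+1) = 0) ->
  forall m n, m <> n -> map_mx v (Q m *m (Q n)^T) = 0.
Proof.
move=> monicQ ttrQ vQ.
have lt_orth m n : (m < n)%N -> map_mx v (Q m *m (Q n)^T) = 0.
  move=> lt_mn; apply: map_mulmx_tr_eq0 => j.
  apply: (orthogonal_lower_degree ttrQ vQ).
  exact: leq_trans (degree_monic d_gt0 monicQ j) lt_mn.
move=> m n; case: (ltngtP m n) => // [lt_mn|lt_nm] _; first exact: lt_orth.
by apply: trmx_inj; rewrite map_trmx trmx_mul trmxK lt_orth // trmx0.
Qed.

(** [V] is a combination of the [Q k] with k < n, all orthogonal to [Q n]; what is left is [a] times
    the invertible Gram matrix. *)
Lemma OPS_top_coef u Q n (a : 'rV[R]_(r d n)) V : is_OPS u Q -> is_monic Q ->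
  degree_lt n V -> map_mx u ((mulrm a (Q n) + V) *m (Q n)^T) = 0 -> a = 0.
Proof.
move=> [_ orthQ gramQ] monicQ degV.
have [c ->] : exists c : forall k, 'rV[R]_(r d k),
    V = \sum_(k < n) mulrm (c k) (Q k).
  have [c hc] := monic_span d_gt0 monicQ (degV 0).
  by exists c; rewrite -hc; apply/matrixP => i j; rewrite !ord1 mxE mulr1n.
rewrite mulmxDl mulmx_suml.
have -> (X : 'rV_(r d n)) (F : 'I_n -> 'rV_(r d n)) :
    map_mx u (X + \sum_k F k) = map_mx u X + \sum_k map_mx u (F k).
  apply/matrixP => i j; rewrite !mxE !summxE linearD linear_sum.
  by congr (_ + _); apply: eq_bigr => k _; rewrite mxE.
rewrite map_mulrmM big1 ?addr0 => [|k _]; last first.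
  rewrite map_mulrmM orthQ ?mulmx0 // => eq_kn.
  by have := ltn_ord k; rewrite eq_kn ltnn.
by move=> a0; rewrite -[a](mulmxK (gramQ n)) a0 mul0mx.
Qed.

End Orthogonality.

(** * The functional [lambda u] and the modified system *)

Section Modification.
Variables (R : realType) (d : nat) (d_gt0 : (0 < d)%N).
Variables (u : {scalar {mpoly R[d]}}) (P : vecseq R d).
Hypotheses (ortP : is_OPS u P) (monicP : is_monic P).
Variables (M : forall n, 'M[R]_(r d n, r d n.-1)).
Variables (N : forall n, 'M[R]_(r d n, r d n.-2)).
Variables (Q : vecseq R d).
Hypothesis (hQ0 : Q 0%N = P 0%N).
Hypothesis (hQ1 : Q 1%N = P 1%N - mulrm (M 1%N) (P 0%N)).
Hypothesis (hQ : forall n : nat,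
  Q n.+2 = P n.+2 - mulrm (M n.+2) (Q n.+1) - mulrm (N n.+2) (Q n)).

Lemma modified_monic : is_monic Q.
Proof.
have monic_step n V : degree_lt n V ->
    degree_lt n (P n - V - Xvec R d n).
  by move=> hV; rewrite addrAC; apply: degree_ltB hV; exact: monicP.
have monic_deg n : degree_lt n (Q n - Xvec R d n) -> degree_lt n.+1 (Q n).
  move=> hn; rewrite -[Q n](subrK (Xvec R d n)); apply: degree_ltD.
    exact: degree_ltW (leqnSn n) hn.
  by move=> j; rewrite mxE msizeX mdeg_mono.
have Q0 : degree_lt 0 (Q 0%N - Xvec R d 0) by rewrite hQ0; exact: monicP.
have Q1 : degree_lt 1 (Q 1%N - Xvec R d 1).
  by rewrite hQ1; apply/monic_step/degree_lt_mulrm; rewrite -hQ0; exact: monic_deg.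
(* The recursion reaches back two indices, so two consecutive bounds are carried. *)
suff QQ n : degree_lt n (Q n - Xvec R d n)
    /\ degree_lt n.+1 (Q n.+1 - Xvec R d n.+1) by move=> n; case: (QQ n).
elim: n => // n [hn hn1]; split=> //.
rewrite hQ -[_ - _ - mulrm _ _]addrA -opprD; apply: monic_step.
apply: degree_ltD; apply: degree_lt_mulrm; first exact: monic_deg.
by apply: degree_ltW (leqnSn _) _; exact: monic_deg.
Qed.

Let monicQ := modified_monic.

(** A column with a single entry, equal to [lambda]; as a vector it can enter matrix identities. *)
Let Lam : 'cV[{mpoly R[d]}]_(r d 0) :=
  mulrm ((N 2%N)^T *m invmx (gram u P 2%N)) (P 2%N)
  + mulrm ((M 1%N)^T *m invmx (gram u P 1%N)) (P 1%N)
  + mulrm (invmx (gram u P 0%N)) (P 0%N).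

Lemma map_lambdaM n (W : 'cV[{mpoly R[d]}]_n) j :
  mulfun (lambda u P M N) u (W j 0) = map_mx u (Lam *m W^T) (ord_r0 d) j.
Proof. by rewrite [RHS]mxE [in RHS]mxE big_ord1 [W^T _ _]mxE. Qed.

Lemma moments_modified n : map_mx (mulfun (lambda u P M N) u) (Q n.+1) = 0.
Proof.
have [_ orthP gramP] := ortP.
(* By orthogonality only the block of index [k] survives, where the Gram matrix cancels its inverse;
   this is why [lambda] contains the inverses. *)
have LamP k : map_mx u (Lam *m (P k)^T) =
    (N 2%N)^T *m invmx (gram u P 2%N) *m map_mx u (P 2%N *m (P k)^T)
    + (M 1%N)^T *m invmx (gram u P 1%N) *m map_mx u (P 1%N *m (P k)^T)
    + invmx (gram u P 0%N) *m map_mx u (P 0%N *m (P k)^T).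
  by rewrite /Lam !mulmxDl !map_mxD !map_mulrmM.
have LamP0 : map_mx u (Lam *m (P 0%N)^T) = 1%:M.
  by rewrite LamP (orthP 2%N 0%N) // (orthP 1%N 0%N) // !mulmx0 !add0r mulVmx.
have LamP1 : map_mx u (Lam *m (P 1%N)^T) = (M 1%N)^T.
  by rewrite LamP (orthP 2%N 1%N) // (orthP 0%N 1%N) // !mulmx0 add0r addr0 mulmxKV.
have LamP2 : map_mx u (Lam *m (P 2%N)^T) = (N 2%N)^T.
  by rewrite LamP (orthP 1%N 2%N) // (orthP 0%N 2%N) // !mulmx0 !addr0 mulmxKV.
have LamP3 k : map_mx u (Lam *m (P k.+3)^T) = 0.
  by rewrite LamP !orthP // !mulmx0 !addr0.
have map_B m k (A : 'M[R]_(m, k)) (V : 'cV_m) (W : 'cV_k) :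
    map_mx u (Lam *m (V - mulrm A W)^T) =
    map_mx u (Lam *m V^T) - map_mx u (Lam *m W^T) *m A^T.
  by rewrite linearB mulmxBr map_mxB map_Mmulrm.
have LamQ1 : map_mx u (Lam *m (Q 1%N)^T) = 0.
  by rewrite hQ1 map_B LamP1 LamP0 mul1mx subrr.
have LamQ2 : map_mx u (Lam *m (Q 2%N)^T) = 0.
  by rewrite hQ !map_B LamP2 LamQ1 hQ0 LamP0 mul1mx mul0mx subr0 subrr.
(* From index 3 on, [P] contributes nothing, so two consecutive zeros propagate through the
   recursion. *)
have LamQ k : map_mx u (Lam *m (Q k.+1)^T) = 0
    /\ map_mx u (Lam *m (Q k.+2)^T) = 0.
  elim: k => [|k [hk hk1]]; first exact (conj LamQ1 LamQ2).
  split; first exact: hk1.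
  by rewrite hQ !map_B LamP3 hk hk1 !mul0mx !subr0.
apply/colP => j; rewrite !mxE map_lambdaM.
by have [-> _] := LamQ n; rewrite mxE.
Qed.

(** As [P 0] is 1, the value is the entry of H_0^{-1} H_0. It fixes the scalar in
    [modified_functional_unique]. *)
Lemma lambda_moment0 : mulfun (lambda u P M N) u 1 = 1.
Proof.
have [_ orthP gramP] := ortP.
rewrite -(monic0 d_gt0 monicP (ord_r0 d)) map_lambdaM.
rewrite /Lam !mulmxDl !map_mxD !map_mulrmM (orthP 2%N 0%N) // (orthP 1%N 0%N) //.
by rewrite !mulmx0 !add0r mulVmx // mxE eqxx.
Qed.

Hypothesis (N2_neq0 : N 2%N <> 0).

(** Since H_2 is invertible and N_2 is nonzero, N_2^T H_2^{-1} has a nonzero entry, which is the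
    coefficient of a monomial of degree two in [lambda]. *)
Lemma msize_lambda : msize (lambda u P M N) = 3%N.
Proof.
have [_ _ gramP] := ortP.
pose A := (N 2%N)^T *m invmx (gram u P 2%N).
have [j Aj] : exists j, A (ord_r0 d) j != 0.
  apply/existsP; apply: contra_notT N2_neq0 => /existsPn A0.
  have A_eq0 : A = 0.
    have ord_eq (i : 'I_(r d 0)) : i = ord_r0 d.
      by apply: val_inj; case: i => [[|i] //=]; rewrite r0.
    by apply/matrixP => i j; rewrite [RHS]mxE (ord_eq i); apply/eqP/negPn/A0.
  by apply: trmx_inj; rewrite trmx0 -[_^T](mulmxKV (gramP 2%N)) -/A A_eq0 mul0mx.
pose V := mulrm ((M 1%N)^T *m invmx (gram u P 1%N)) (P 1%N)
  + mulrm (invmx (gram u P 0%N)) (P 0%N).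
have degV : degree_lt 2 V.
  apply: degree_ltD; apply: degree_lt_mulrm; first exact: degree_monic.
  by apply: (@degree_ltW _ _ _ 1) => //; exact: degree_monic.
have -> : lambda u P M N = mulrm A (P 2%N) (ord_r0 d) 0 + V (ord_r0 d) 0.
  by rewrite /lambda -addrA mxE.
have size_top := msize_mulrm_monic d_gt0 monicP Aj.
apply/eqP; rewrite eqn_leq; apply/andP; split.
  apply: leq_trans (msizeD_le _ _) _; rewrite size_top geq_max leqnn /=.
  exact: leqW (degV _).
have /msize_mdeg_lt : mono j \in
    msupp (mulrm A (P 2%N) (ord_r0 d) 0 + V (ord_r0 d) 0).
  rewrite mcoeff_msupp mcoeffD mcoeff_mulrm_monic //.
  by rewrite (mcoeff_degree (degV _)) ?mdeg_mono // addr0.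
by rewrite mdeg_mono.
Qed.

Variables (Bh : forall n, 'I_d -> 'M[R]_(r d n)).
Variables (Ch : forall n, 'I_d -> 'M[R]_(r d n, r d n.-1)).
Hypothesis (ttrQ : three_term Q Bh Ch).

(* If [c *m gram v Q n = 0] for [v = lambda u], then [p = c Q_n] satisfies
   [u (lambda p P_{n+2}^T) = v (p P_{n+2}^T) = 0], because only the component
   [N_{n+2} Q_n] of [P_{n+2}] could contribute.  So [lambda p] has degree at most
   [n + 1], which forces [p = 0] since [lambda] has degree two. *)
Lemma gram_modified_unit n :
  gram (mulfun (lambda u P M N) u) Q n \in unitmx.
Proof.
set v : {scalar {mpoly R[d]}} := mulfun (lambda u P M N) u.
have orthQ := orthogonal_monic d_gt0 monicQ ttrQ moments_modified.
rewrite -row_free_unit; apply: inj_row_free => c c_gram.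
apply/eqP; apply: contraT => /rV0Pn[j cj].
pose p := mulrm c (Q n) 0 0.
have size_p : msize p = n.+1 := msize_mulrm_monic d_gt0 monicQ cj.
(* Degrees add, real polynomials forming a domain: sizes 3 and n + 1 stand for degrees 2 and n,
   hence size n + 3. *)
have size_lp : msize (lambda u P M N * p) = n.+3.
  rewrite msizeM ?msize_lambda ?size_p //.
    by rewrite -(mmeasure_poly_eq0 mdeg) msize_lambda.
  by rewrite -(mmeasure_poly_eq0 mdeg) size_p.
have : (msize (lambda u P M N * p)%R <= n.+3)%N by rewrite size_lp.
move/(monic_span d_gt0 monicP) => [a].
rewrite big_ord_recr /= addrC; set V := \sum_(k < _) _ => lpE.
have degV : degree_lt n.+2 V := degree_sum_monic d_gt0 monicP _ _.
suff a0 : a n.+2 = 0.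
  have := degV 0; move/matrixP/(_ 0 0): lpE.
  rewrite a0 mulrm0l add0r mxE eqxx mulr1n => <-.
  by rewrite size_lp ltnn.
apply: (OPS_top_coef d_gt0 ortP monicP degV); rewrite -lpE.
have -> : map_mx u ((lambda u P M N * p)%:M *m (P n.+2)^T) =
    map_mx v (mulrm c (Q n) *m (P n.+2)^T).
  apply/matrixP => i k; rewrite !ord1 mul_scalar_mx [LHS]mxE [in LHS]mxE.
  by rewrite [RHS]mxE [in RHS]mxE big_ord1 /v /= /mulfun mulrA.
have trD (V1 V2 : 'cV[{mpoly R[d]}]_(r d n.+2)) : (V1 + V2)^T = V1^T + V2^T.
  exact: linearD.
have -> : P n.+2 = Q n.+2 + mulrm (M n.+2) (Q n.+1) + mulrm (N n.+2) (Q n).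
  by rewrite hQ addrAC !subrK.
rewrite map_mulrmM !trD !mulmxDr !map_mxD !map_Mmulrm.
have ne1 : n <> n.+1 by move/eqP; rewrite ltn_eqF.
have ne2 : n <> n.+2 by move/eqP; rewrite ltn_eqF // ltnW.
rewrite (orthQ _ _ ne1) (orthQ _ _ ne2) mul0mx !add0r.
by rewrite mulmxA c_gram mul0mx.
Qed.

Lemma modified_OPS : is_OPS (mulfun (lambda u P M N) u) Q.
Proof.
split; first exact: monic_PS.
  exact (orthogonal_monic d_gt0 monicQ ttrQ moments_modified).
exact: gram_modified_unit.
Qed.

(** As [Q 0] is 1, orthogonality to it makes [v] vanish on all later [Q n], as [lambda u] does, so
    only the values at 1 matter. The factor [v 1] is unavoidable: orthogonality survives nonzero
    scaling of [v]. *)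
Lemma modified_functional_unique (v : {scalar {mpoly R[d]}}) :
  is_OPS v Q -> forall p, v p = v 1 * mulfun (lambda u P M N) u p.
Proof.
move=> [_ orthQ _]; apply: (scalar_eq_on_monic d_gt0 monicQ) => -[|n].
  apply/colP => j; rewrite [LHS]mxE [RHS]mxE [in RHS]mxE.
  rewrite (monic0 d_gt0 monicQ) -[LHS]mulr1; congr (_ * _).
  exact/esym/lambda_moment0.
rewrite /= moments_modified scaler0; apply/colP => j; rewrite !mxE.
have ne0 : n.+1 <> 0%N by [].
have /matrixP/(_ j (ord_r0 d)) := orthQ _ _ ne0.
by rewrite !mxE big_ord1 mxE (monic0 d_gt0 monicQ) mulr1.
Qed.

End Modification.

Theorem theorem4p3 (R : realType) (d : nat) (hd : (0 < d)%N)
  (u : {scalar {mpoly R[d]}}) (P : vecseq R d)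
  (B : forall n : nat, 'I_d -> 'M[R]_(r d n))
  (C : forall n : nat, 'I_d -> 'M[R]_(r d n, r d n.-1))
  (hP : monic_OPS_with u P B C)
  (M : forall n : nat, 'M[R]_(r d n, r d n.-1))
  (N : forall n : nat, 'M[R]_(r d n, r d n.-2))
  (hN : N 2%N <> 0)
  (Q : vecseq R d)
  (hQ0 : Q 0%N = P 0%N)
  (hQ1 : Q 1%N = P 1%N - mulrm (M 1%N) (P 0%N))
  (hQ : forall n : nat,
     Q n.+2 = P n.+2 - mulrm (M n.+2) (Q n.+1) - mulrm (N n.+2) (Q n))
  (Bh : forall n : nat, 'I_d -> 'M[R]_(r d n))
  (Ch : forall n : nat, 'I_d -> 'M[R]_(r d n, r d n.-1)) :
  ((exists v : {scalar {mpoly R[d]}}, monic_OPS_with v Q Bh Ch)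
   <->
   (forall i : 'I_d,
      [/\ Bh 0%N i = B 0%N i + L R 0%N i *m M 1%N
          /\ (forall n : nat, Bh n.+1 i =
                B n.+1 i - M n.+1 *m L R n i + L R n.+1 i *m M n.+2),
          Ch 1%N i = C 1%N i - M 1%N *m Bh 0%N i + B 1%N i *m M 1%N + L R 1%N i *m N 2%N
          /\ (forall n : nat, Ch n.+2 i =
                C n.+2 i - M n.+2 *m Bh n.+1 i + B n.+2 i *m M n.+2
                - N n.+2 *m L R n i + L R n.+2 i *m N n.+3),
          forall n : nat,
            M n.+2 *m Ch n.+1 i + N n.+2 *m Bh n i
            = C n.+2 i *m M n.+1 + B n.+2 i *m N n.+2
        & forall n : nat, C n.+3 i *m N n.+2 = N n.+3 *m Ch n.+1 i]))
  /\
  ((exists v : {scalar {mpoly R[d]}}, monic_OPS_with v Q Bh Ch) ->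
   [/\ msize (lambda u P M N) = 3%N,
       monic_OPS_with (mulfun (lambda u P M N) u) Q Bh Ch
     & forall v : {scalar {mpoly R[d]}}, monic_OPS_with v Q Bh Ch ->
         forall p : {mpoly R[d]}, v p = v 1 * mulfun (lambda u P M N) u p]).
Proof.
have [_ ortP monicP ttrP] := hP.
have monicQ := modified_monic hd monicP hQ0 hQ1 hQ.
have ttr_rel := three_term_relations ttrP hQ0 hQ1 hQ Bh Ch hd monicQ.
have OPSQ : three_term Q Bh Ch ->
    monic_OPS_with (mulfun (lambda u P M N) u) Q Bh Ch.
  move=> ttrQ.
  have ortQ := modified_OPS hd ortP monicP hQ0 hQ1 hQ hN ttrQ.
  (* Quasi-definiteness is witnessed by [Q] itself. *)
  by split=> //; exists Q.
split; first split.
- by case=> v [_ _ _ /ttr_rel].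
(* The functional left open by [eexists] is filled by [OPSQ] with [lambda u]. *)
- by move=> rel; eexists; apply/OPSQ/ttr_rel.
case=> v [_ _ _ /OPSQ ortQ]; split=> //; first exact: msize_lambda.
by move=> w [_ ortw _ _]; apply: modified_functional_unique ortw.
Qed.
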